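(* For $z\in\mathbb{C}$, the coherent state $|z\rangle$ of the generalized Heisenberg algebra $\mathrm{GHA}_f$ is given by $$|z\rangle=e_{f}^{-\frac{|z|^{2}}{2}}\sum_{n=0}^{\infty}\frac{z^{n}}{\sqrt{[n]_{f}(\alpha_{0})!}}\,|n\rangle .$$
   Context: The generalized Heisenberg algebra $\mathrm{GHA}_f$ is generated by $\{a,a^{\dagger},H\}$ with relations $$aH=f(H)a,\qquad Ha^{\dagger}=a^{\dagger}f(H),\qquad [a,a^{\dagger}]=aa^{\dagger}-a^{\dagger}a=f(H)-H,$$ where $H$ is the self-conjugate Hamiltonian of the system and $f(H)$ is an analytic function of $H$, called the characteristic function of the algebra. For a positive integer $k$, $f^{k}$ is the $k$-fold composition of $f$, $f^{-k}$ is the $k$-fold composition of the compositional inverse $f^{-1}$, and $f^{0}$ is the identity function. For $k\in\mathbb{Z}$, the quantum operator functions are $[k]_f(H)=f^{k}(H)-H$; correspondingly, for a number $x$, $[k]_f(x)=f^{k}(x)-x$. Fock space representation: the number states $\{|n\rangle\}_{n\ge 0}$ form an orthonormal basis of eigenstates of $H$, with $H|m\rangle=\alpha_m|m\rangle$, where $\alpha_0$ is the lowest eigenvalue of $H$, corresponding to the vacuum state $|0\rangle$, and $\alpha_m=f^{m}(\alpha_0)$. The operators $a$ and $a^\dagger$ act by $$a|m\rangle=\sqrt{[m]_f(\alpha_0)}\,|m-1\rangle,\quad a|0\rangle=0,\quad a^{\dagger}|m\rangle=\sqrt{[m+1]_f(\alpha_0)}\,|m+1\rangle .$$ Quantum operator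 factorials: $[0]_f(\alpha_0)!=1$ and $[n]_f(\alpha_0)!=[n]_f(\alpha_0)[n-1]_f(\alpha_0)\cdots[1]_f(\alpha_0)$ for $n\ge1$. Quantum operator exponential function: $e_f^{x}=\sum_{n=0}^{\infty}\frac{x^{n}}{[n]_f(\alpha_0)!}$. The coherent states $|z\rangle$, $z\in\mathbb{C}$, are defined as the eigenstates of the annihilation operator: $a|z\rangle=z|z\rangle$, equivalently $\langle z|a^{\dagger}=\langle z|\overline{z}$, with $\langle z|z\rangle=1$.
   Formalization: The prefactor is taken as (e_f^{|z|^2})^{-1/2}, not the series e_f^x at x=-|z|^2/2, which does not normalize for general f; |z> is unique up to a phase (fixed by <0|z> >= 0), and its existence is claimed when e_f^{|z|^2} converges. *)

(* Defs.v *)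
From HB Require Import structures.
From mathcomp Require Import all_boot all_order all_algebra.
From mathcomp Require Import all_classical all_reals all_analysis.
From mathcomp Require Import sesquilinear complex.

Set Implicit Arguments.
Unset Strict Implicit.
Unset Printing Implicit Defensive.

Import Order.TTheory GRing.Theory Num.Theory.
Import numFieldNormedType.Exports.

Local Open Scope classical_set_scope.
Local Open Scope ring_scope.
Local Open Scope complex_scope.

Section QuantumOperatorFunctions.
Context {R : realType}.
Implicit Types (f : R -> R) (x y : R) (n : nat).

Definition analytic_at f x :=
  exists c : nat -> R, \forall y \near x, pseries c (y - x) @ \oo --> f y.

Definition qnum f n x : R := iter n f x - x.

Definition qfact f x n : R := \prod_(1 <= k < n.+1) qnum f k x.

(* coefficients of the quantum operator exponential e_f^y (base point x) *)
Definition qexp_coef f x n : R := (qfact f x n)^-1.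

Definition qexp f x y : R := limn (pseries (qexp_coef f x) y).

End QuantumOperatorFunctions.

(* Possibly unbounded linear operators; the values of [op_app] outside
   [op_dom] are irrelevant. *)
Record operator (K : numFieldType) (V : normedModType K) := Operator {
  op_dom : set V;
  op_app :> V -> V;
  op_dom_linear : forall c u v,
    op_dom u -> op_dom v -> op_dom (c *: u + v);
  op_app_linear : forall c u v,
    op_dom u -> op_dom v -> op_app (c *: u + v) = c *: op_app u + op_app v
}.

Section FockSpace.
Context {R : realType} {V : completeNormedModType R[i]}.
Variable d : {dot V for Num.conj}.
Implicit Types (u v w psi phi : V) (A B : operator V) (f : R -> R).

(* [d] induces the norm of [V], which is complete: [V] is a Hilbert space *)
Definition hilbert_dot := forall u, `|u| ^+ 2 = d u u.

(* A [{dot V for Num.conj}] is linear in its first argument, while <u|v> is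
   linear in v and conjugate-linear in u. *)
Definition braket u v : R[i] := d v u.

Definition span (e : nat -> V) : set V :=
  [set u | exists n (c : nat -> R[i]), u = \sum_(i < n) c i *: e i].

Definition orthonormal_basis (e : nat -> V) :=
  (forall m n, braket (e m) (e n) = (m == n)%:R) /\ closure (span e) = setT.

(* B = A^* for a densely defined A *)
Definition is_adjoint A B := forall phi w,
  (op_dom B phi /\ B phi = w) <->
  (forall psi, op_dom A psi -> braket phi (A psi) = braket w psi).

(* A is the closure of its restriction to D *)
Definition closure_from A (D : set V) :=
  [set p : V * V | op_dom A p.1 /\ p.2 = A p.1] =
  closure [set p : V * V | D p.1 /\ p.2 = A p.1].

(* [fH] stands for f(H): it acts as f(l) on the eigenvectors of H for the
   eigenvalue l.  The operators considered below have an eigenbasis, so this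
   describes the functional calculus on it. *)
Definition is_function_of f H fH := forall (l : R) psi,
  op_dom H psi -> H psi = l%:C *: psi ->
  op_dom fH psi /\ fH psi = (f l)%:C *: psi.

(* Representation of GHA_f by operators a, ad (for a^dagger) and H, the
   relations being read on an invariant domain D. *)
Record gha_rep f (D : set V) (a ad H fH : operator V) : Prop := {
  gha_fun : is_function_of f H fH;
  gha_selfadj : is_adjoint H H;
  gha_adj : is_adjoint a ad;
  gha_dom : forall A, A = a \/ A = ad \/ A = H \/ A = fH ->
    forall u, D u -> op_dom A u /\ D (A u);
  gha_aH : forall u, D u -> a (H u) = fH (a u);
  gha_Had : forall u, D u -> H (ad u) = ad (fH u);
  gha_comm : forall u, D u -> a (ad u) - ad (a u) = fH u - H u
}.

(* Fock representation with number states |n> = ket n and H |0> = alpha0 |0>.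
   The eigenvalues of H are the alpha_m = f^m(alpha0); that alpha0 is the
   lowest one, belonging to the vacuum |0> only, is [fock_lowest]; it makes
   every [m]_f(alpha0), m > 0, positive.  The operator a is extended from
   finite combinations of number states by closure. *)
Record fock_rep f (alpha0 : R) (ket : nat -> V) (a ad H fH : operator V)
    : Prop := {
  fock_basis : orthonormal_basis ket;
  fock_gha : gha_rep f (span ket) a ad H fH;
  fock_lowest : forall m, (0 < m)%N -> alpha0 < iter m f alpha0;
  fock_H : forall m, H (ket m) = (iter m f alpha0)%:C *: ket m;
  fock_a : forall m,
    a (ket m.+1) = (Num.sqrt (qnum f m.+1 alpha0))%:C *: ket m;
  fock_a0 : a (ket 0%N) = 0;
  fock_ad : forall m,
    ad (ket m) = (Num.sqrt (qnum f m.+1 alpha0))%:C *: ket m.+1;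
  fock_closure : closure_from a (span ket)
}.

Definition coherent_state (a : operator V) (z : R[i]) psi :=
  [/\ op_dom a psi, a psi = z *: psi & braket psi psi = 1].

Definition coherent_term f (alpha0 : R) (ket : nat -> V) (z : R[i]) (n : nat)
    : V :=
  (z ^+ n / (Num.sqrt (qfact f alpha0 n))%:C) *: ket n.

(* |z|^2 as an element of R *)
Definition sqmod (z : R[i]) : R := Normc.normc z ^+ 2.

(* In the prefactor, the exponent -1/2 is applied to the number
   e_f^{|z|^2}: it is (e_f^{|z|^2})^{-1/2}, not the exponential series
   evaluated at -|z|^2/2 (unless [n]_f(alpha0) is proportional to n, the
   latter does not normalize the vector). *)
Definition coherent_vector f (alpha0 : R) (ket : nat -> V) (z : R[i]) : V :=
  (qexp f alpha0 (sqmod z) `^ (- 2^-1))%:C *: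
    limn (series (coherent_term f alpha0 ket z)).

End FockSpace.

(* Main.v *)
Require Import Defs.
From HB Require Import structures.
From mathcomp Require Import all_boot all_order all_algebra.
From mathcomp Require Import all_classical all_reals all_analysis.
From mathcomp Require Import sesquilinear complex.

Set Implicit Arguments.
Unset Strict Implicit.
Unset Printing Implicit Defensive.

Import Order.TTheory GRing.Theory Num.Theory.
Import numFieldNormedType.Exports.

Local Open Scope classical_set_scope.
Local Open Scope ring_scope.
Local Open Scope complex_scope.

(** Write t_n = z^n / sqrt([n]_f(alpha0)!), so that the vector of the theorem is
    the normalization of the series of the t_n |n>.

    Uniqueness.  If a psi = z psi, moving a to the other side of the inner
    product gives z <n|psi> = <n|a psi> = <a^dagger n|psi> =
    sqrt([n+1]_f(alpha0)) <n+1|psi>, a recurrence whose solution is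
    <n|psi> = <0|psi> t_n ([coherent_recurrence]).  As the number states form
    an orthonormal basis, psi is the sum of its Fourier series
    ([fourier_cvg]), that is <0|psi> times the series of the t_n |n>.  Hence
    <0|psi> <> 0, the latter series converges, and by Parseval
    ([orthogonal_series_norm]) its squared norm 1 / |<0|psi>|^2 is the sum of
    the |t_n|^2, which is e_f^{|z|^2}.  So (e_f^{|z|^2})^{-1/2} = |<0|psi>|,
    and psi differs from the vector of the theorem by the phase
    <0|psi> / |<0|psi>|.

    Existence.  If the numerical series e_f^{|z|^2} converges, then so does the
    series of the t_n |n>, by orthogonality and completeness
    ([orthogonal_series_cvg]).  The operator a may be unbounded, hence cannot
    be applied to that series term by term; but a maps the partial sum of order
    n+1 to z times the one of order n, and the graph of a is closed, so the sum
    is in the domain of a and is an eigenvector for z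
    ([annihilation_coherent_series]).  Its squared norm is e_f^{|z|^2}, and the
    prefactor makes it a unit vector. *)

Lemma normc_real (R : rcfType) (x : R) : `|x%:C| = `|x|%:C :> R[i].
Proof. by rewrite normc_def /= expr0n /= addr0 sqrtr_sqr. Qed.

(** The norm of a complex normed space takes its values in R[i], while
    e_f^{|z|^2} is a series in R: this transfers limits between the two.  The
    ascriptions to [numFieldType] select the topology that R[i] has as a normed
    field. *)
Lemma cvgn_real_complex (R : realType) (u : nat -> R) (l : R) :
  (fun n => (u n)%:C : (R[i] : numFieldType)) @ \oo -->
    (l%:C : (R[i] : numFieldType)) <->
  u @ \oo --> l.
Proof.
have distE n : `|l%:C - (u n)%:C| = `|l - u n|%:C :> R[i].
  by rewrite -rmorphB normc_real.
split=> /cvgrPdist_lt ul; apply/cvgrPdist_lt => e e0.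
  have := ul e%:C; rewrite ltcR => /(_ e0); apply: filterS => n.
  by rewrite distE ltcR.
(* A positive complex number is real. *)
move: (e0); rewrite ltcE /= => /andP[/eqP eI eR].
have := ul _ eR; apply: filterS => n un.
by rewrite distE ltcE /= eI eqxx.
Qed.

(** The domain axiom of an operator only mentions c u + v, so k u is written
    (k - 1) u + u. *)
Lemma operator_scale (K : numFieldType) (V : normedModType K) (A : operator V)
    (k : K) (u : V) :
  op_dom A u -> op_dom A (k *: u) /\ A (k *: u) = k *: A u.
Proof.
have -> : k *: u = (k - 1) *: u + u by rewrite scalerBl scale1r subrK.
move=> dom_u; split; first exact: op_dom_linear.
by rewrite op_app_linear// scalerBl scale1r subrK.
Qed.

(** * Series along an orthonormal family *)

Section OrthonormalFamily.
Context {R : realType} {V : completeNormedModType R[i]}.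
Variables (d : {dot V for Num.conj}) (e : nat -> V).
Hypothesis d_hilbert : hilbert_dot d.
Hypothesis e_orthonormal : forall m n, braket d (e m) (e n) = (m == n)%:R.
Implicit Types (c b : nat -> R[i]) (u v : V) (x : nat -> R).

Lemma dot_comb_basis c m n j :
  d (\sum_(m <= i < n) c i *: e i) (e j) = if (m <= j < n)%N then c j else 0.
Proof.
rewrite linear_sumlz -(big_nat1_eq +%R c) [RHS]big_mkcond; apply: eq_bigr => i _.
rewrite linearZl_LR /= [d _ _]e_orthonormal eq_sym.
by case: eqP => _; rewrite ?mulr1 ?mulr0.
Qed.

Lemma dot_comb u c m n :
  d u (\sum_(m <= i < n) c i *: e i) =
    \sum_(m <= i < n) Num.conj (c i) * d u (e i).
Proof. by rewrite linear_sumr; apply: eq_bigr => i _; rewrite linearZr_LR. Qed.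

Lemma norm_comb c m n :
  `|\sum_(m <= i < n) c i *: e i| ^+ 2 = \sum_(m <= i < n) `|c i| ^+ 2.
Proof.
rewrite d_hilbert dot_comb [LHS]big_nat_cond [RHS]big_nat_cond.
by apply: eq_bigr => i /andP[mn _]; rewrite dot_comb_basis mn normCKC.
Qed.

(** The residual u - s, for s the Fourier sum, is orthogonal to the first n basis
    vectors, hence to the difference r between s and any other combination of
    them; Pythagoras applied to (u - s) + r concludes. *)
Lemma fourier_sum_minimizes u b n :
  `|u - \sum_(0 <= i < n) braket d (e i) u *: e i| <=
  `|u - \sum_(0 <= i < n) b i *: e i|.
Proof.
set s := \sum_(0 <= i < n) braket d (e i) u *: e i.
rewrite -(@ler_pXn2r _ 2) ?nnegrE//.
pose r := \sum_(0 <= i < n) (braket d (e i) u - b i) *: e i.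
have -> : u - \sum_(0 <= i < n) b i *: e i = (u - s) + r.
  rewrite -addrA; congr (u + _).
  have -> : r = s - \sum_(0 <= i < n) b i *: e i.
    by rewrite -sumrB; apply: eq_bigr => i _; rewrite scalerBl.
  by rewrite addKr.
have us_r : d (u - s) r = 0.
  rewrite dot_comb big_nat_cond big1// => i /andP[i_n _].
  by rewrite linearBl /= dot_comb_basis i_n subrr mulr0.
have -> : `|u - s + r| ^+ 2 = `|u - s| ^+ 2 + `|r| ^+ 2.
  by rewrite !d_hilbert; exact: hnormDd.
by rewrite lerDl exprn_ge0.
Qed.

(** Density provides a finite combination within eps of u, of length N; for
    n >= N the Fourier sum of order n is at least as close to u. *)
Lemma fourier_cvg u : closure (Defs.span e) = setT ->
  series (fun i => braket d (e i) u *: e i) @ \oo --> u.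
Proof.
move=> e_total; apply/cvgrPdist_lt => eps eps0.
have : closure (Defs.span e) u by rewrite e_total.
move=> /(_ _ (nbhsx_ballx u eps eps0)) [_ [[N [b ->]]]].
rewrite -ball_normE /= => ub.
near=> n; apply: le_lt_trans ub.
have Nn : (N <= n)%N by near: n; exact: nbhs_infty_ge.
have -> : \sum_(i < N) b i *: e i =
    \sum_(0 <= i < n) (if (i < N)%N then b i else 0) *: e i.
  rewrite (@big_cat_nat _ _ _ N)//= [X in _ = _ + X]big_nat_cond.
  rewrite [X in _ = _ + X]big1 ?addr0 => [|i /andP[/andP[Ni _] _]].
    by rewrite big_mkord; apply: eq_bigr => i _; rewrite ltn_ord.
  by rewrite ltnNge Ni scale0r.
exact: fourier_sum_minimizes.
Unshelve. all: by end_near. Qed.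

(** The squared norm of a block of the vector series is the corresponding block
    of the numerical series, so the Cauchy criterion carries over, with eps
    replaced by eps^2.  The squared norms are given as reals [x i] in order to
    apply to real series. *)
Lemma orthogonal_series_cvg c x : (forall i, `|c i| ^+ 2 = (x i)%:C) ->
  cvgn (series x) -> cvgn (series (fun i => c i *: e i)).
Proof.
move=> cx /cauchy_cvgP/cauchy_seriesP x_cauchy.
apply/cauchy_cvgP/cauchy_seriesP => eps eps0.
have epsE : eps = (complex.Re eps)%:C by rewrite RRe_real// gtr0_real.
have r0 : 0 < complex.Re eps ^+ 2 by rewrite exprn_gt0// -ltcR -epsE.
apply: filterS (x_cauchy _ r0) => -[m n] /= mn.
rewrite -(@ltr_pXn2r _ 2) ?nnegrE ?(ltW eps0)//.
rewrite norm_comb (eq_bigr _ (fun i _ => cx i)) -rmorph_sum epsE -rmorphXn ltcR.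
exact: le_lt_trans (ler_norm _) mn.
Qed.

(** Parseval: the squared norms of the partial sums are the partial sums of the
    numerical series, and the norm is continuous.  This also yields the
    convergence of the numerical series from that of the vector series. *)
Lemma orthogonal_series_norm c x v : (forall i, `|c i| ^+ 2 = (x i)%:C) ->
  series (fun i => c i *: e i) @ \oo --> v ->
  exists2 nu, `|v| ^+ 2 = nu%:C & series x @ \oo --> nu.
Proof.
move=> cx sv; have vE : `|v| ^+ 2 = (complex.Re (`|v| ^+ 2))%:C.
  by rewrite RRe_real// ger0_real// exprn_ge0.
exists (complex.Re (`|v| ^+ 2)) => //; apply/cvgn_real_complex; rewrite -vE.
have -> : (fun n => (series x n)%:C) =
    (fun n => `|series (fun i => c i *: e i) n| ^+ 2).
  apply/funext => n; rewrite norm_comb rmorph_sum /=.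
  by apply: eq_bigr => i _; rewrite cx.
rewrite expr2; under eq_fun do rewrite expr2.
by apply: cvgM; apply: cvg_norm.
Qed.

End OrthonormalFamily.

(** * The eigenvalue equation of the annihilation operator *)

Section CoherentStates.
Context {R : realType} {V : completeNormedModType R[i]}.
Variables (d : {dot V for Num.conj}) (f : R -> R) (alpha0 : R).
Variables (ket : nat -> V) (a ad H fH : operator V) (z : R[i]).
Hypothesis fock : fock_rep d f alpha0 ket a ad H fH.

Local Notation psum := (series (coherent_term f alpha0 ket z)).

Let coef n : R[i] := z ^+ n / (Num.sqrt (qfact f alpha0 n))%:C.

Lemma qfact_gt0 n : 0 < qfact f alpha0 n.
Proof.
rewrite /qfact big_nat_cond; apply: prodr_gt0 => k /andP[/andP[k0 _] _].
by rewrite subr_gt0 (fock_lowest fock).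
Qed.

(** The common recurrence behind both directions: sqrt([n+1]_f(alpha0)) is the
    matrix coefficient of a and of a^dagger between |n> and |n+1>. *)
Lemma coherent_coefS n :
  (Num.sqrt (qnum f n.+1 alpha0))%:C * coef n.+1 = z * coef n.
Proof.
have q0 : 0 < qnum f n.+1 alpha0 by rewrite subr_gt0 (fock_lowest fock).
rewrite /coef /qfact big_nat_recr//= sqrtrM ?(ltW (qfact_gt0 n))// rmorphM.
have sq0 : (Num.sqrt (qnum f n.+1 alpha0))%:C != 0 :> R[i].
  by rewrite fmorph_eq0 sqrtr_eq0 -ltNge.
by rewrite invfM mulrCA [X in _ * X]mulrCA mulfV// mulr1 exprS mulrA.
Qed.

(** |t_n|^2 is the general term of the series e_f^{|z|^2}. *)
Lemma coherent_coef_norm n :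
  `|coef n| ^+ 2 = (qexp_coef f alpha0 n * sqmod z ^+ n)%:C.
Proof.
have s2 :
  (Num.sqrt (qfact f alpha0 n))%:C ^+ 2 = (qfact f alpha0 n)%:C :> R[i].
  by rewrite -rmorphXn sqr_sqrtr// ltW// qfact_gt0.
have z2 : `|z| ^+ 2 = (sqmod z)%:C by rewrite /sqmod rmorphXn.
rewrite normrM normrX normfV normc_real (ger0_norm (sqrtr_ge0 _)).
rewrite exprMn exprVn s2 exprAC z2 mulrC.
by rewrite -fmorphV -rmorphXn -rmorphM.
Qed.

Lemma span_dom_a u : Defs.span ket u -> op_dom a u.
Proof. by move=> /(gha_dom (fock_gha fock) (or_introl erefl))[]. Qed.

Lemma span_ket n : Defs.span ket (ket n).
Proof.
exists n.+1, (fun i => (i == n)%:R).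
rewrite big_ord_recr /= eqxx scale1r big1 ?add0r// => i _.
by rewrite ltn_eqF// scale0r.
Qed.

Lemma span_series_coherent n : Defs.span ket (psum n).
Proof. by exists n, coef; rewrite /series /= big_mkord. Qed.

(** The index drops by one because a lowers |n> to |n-1> and kills |0>. *)
Lemma a_series_coherent n :
  a (psum n.+1) = z *: psum n.
Proof.
have sS k : psum k.+1 = coef k *: ket k + psum k.
  by rewrite addrC /series /= big_nat_recr.
have aS k : a (psum k.+1) = coef k *: a (ket k) + a (psum k).
  rewrite sS op_app_linear//; apply: span_dom_a; first exact: span_ket.
  exact: span_series_coherent.
have as0 : a (psum 0%N) = 0.
  have dom0 := span_dom_a (span_ket 0).
  rewrite [psum 0%N]big_geq//; have := op_app_linear (-1) dom0 dom0.
  by rewrite !scaleN1r !addNr.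
elim: n => [|n IH].
  by rewrite aS as0 (fock_a0 fock) scaler0 addr0 [psum 0%N]big_geq// scaler0.
rewrite aS IH (fock_a fock) scalerA mulrC coherent_coefS -scalerA -scalerDr.
by rewrite sS.
Qed.

(** Only the matrix coefficients of a against number states are used, through
    its adjoint; psi may lie outside of the span of the number states, where
    the action of a is not given by a formula. *)
Lemma coherent_recurrence psi : op_dom a psi -> a psi = z *: psi ->
  forall n, braket d (ket n) psi = braket d (ket 0%N) psi * coef n.
Proof.
move=> dom_psi a_psi; elim=> [|n IH].
  by rewrite /coef /qfact big_geq// sqrtr1 expr0 divr1 mulr1.
have [dom_ad _] :=
  gha_dom (fock_gha fock) (or_intror (or_introl erefl)) (span_ket n).
have [adE _] := gha_adj (fock_gha fock) (ket n) (ad (ket n)).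
have := adE (conj dom_ad erefl) psi dom_psi.
rewrite a_psi (fock_ad fock) /braket linearZl_LR linearZr_LR /=.
set q := Num.sqrt _; rewrite -!/(braket _ _ _) IH.
have -> : q%:C^*%R = q%:C by rewrite conj_Creal// ger0_real// ler0c sqrtr_ge0.
have q0 : q%:C != 0.
  rewrite fmorph_eq0 sqrtr_eq0 -ltNge subr_gt0.
  exact: (fock_lowest fock).
by rewrite /= mulrCA -coherent_coefS mulrCA => /(mulfI q0) ->.
Qed.

(** The points (psum n.+1, z psum n) are on the graph of the restriction of a to
    finite combinations of number states, whose closure is the graph of a. *)
Lemma annihilation_coherent_series u :
  psum @ \oo --> u -> op_dom a u /\ a u = z *: u.
Proof.
move=> su; have : [set p : V * V | op_dom a p.1 /\ p.2 = a p.1] (u, z *: u).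
  rewrite (fock_closure fock).
  apply: (@closed_cvg _ _ \oo _ (fun n =>
    (psum n.+1, z *: psum n)) _ (@closed_closure _ _)).
    apply: nearW => n; apply: subset_closure; split=> /=.
      exact: span_series_coherent.
    by rewrite a_series_coherent.
  apply: cvg_pair; last exact: cvgZl_tmp.
  by rewrite (cvg_shiftS psum).
by case=> /= ? ->.
Qed.

End CoherentStates.

Theorem theorem3p1 (R : realType) (V : completeNormedModType R[i])
    (d : {dot V for Num.conj}) (f : R -> R) (alpha0 : R) (ket : nat -> V)
    (a ad H fH : operator V)
    (d_hilbert : hilbert_dot d)
    (f_analytic : forall m : nat, analytic_at f (iter m f alpha0))
    (fock : fock_rep d f alpha0 ket a ad H fH)
    (z : R[i]) :
  (* a coherent state is the given vector, up to the choice of its phase *)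
  (forall psi : V, coherent_state d a z psi ->
     [/\ cvgn (pseries (qexp_coef f alpha0) (sqmod z)),
         cvgn (series (coherent_term f alpha0 ket z)),
         exists2 c : R[i], `|c| = 1 &
           psi = c *: coherent_vector f alpha0 ket z
       & 0 <= braket d (ket 0%N) psi ->
         psi = coherent_vector f alpha0 ket z]) /\
  (* the given vector is a coherent state as soon as e_f^{|z|^2} exists *)
  (cvgn (pseries (qexp_coef f alpha0) (sqmod z)) ->
     cvgn (series (coherent_term f alpha0 ket z)) /\
     coherent_state d a z (coherent_vector f alpha0 ket z)).
Proof.
have [orth total] := fock_basis fock.
have coefE := coherent_coef_norm z fock.
split=> [psi [dom_psi a_psi psi1]|qexp_cvg].
  set c0 := braket d (ket 0%N) psi.
  have psi_norm : `|psi| = 1.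
    by apply/eqP; rewrite -(@eqrXn2 _ 2)// expr1n d_hilbert; apply/eqP.
  have s_psi : c0 *: series (coherent_term f alpha0 ket z) n @[n --> \oo] --> psi.
    rewrite (_ : (fun n => _) = series (fun i => braket d (ket i) psi *: ket i)).
      exact: fourier_cvg.
    apply/funext => n; rewrite /series /= scaler_sumr; apply: eq_bigr => i _.
    by rewrite (coherent_recurrence fock dom_psi a_psi) -scalerA.
  (* Otherwise psi would be the limit of the zero sequence. *)
  have c00 : c0 != 0.
    apply/eqP => c00; move: s_psi; rewrite c00.
    under eq_fun do rewrite scale0r.
    move=> /(cvg_unique _ (cvg_cst (0 : V))) => /(_ (@norm_hausdorff _ V)) psi0.
    by move/eqP: psi_norm; rewrite -psi0 normr0 eq_sym oner_eq0.
  have s_cvg : series (coherent_term f alpha0 ket z) @ \oo --> c0^-1 *: psi.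
    rewrite (_ : series _ =
        c0^-1 \*: (fun n => c0 *: series (coherent_term f alpha0 ket z) n)).
      exact: cvgZl_tmp.
    by apply/funext => n /=; rewrite scalerA mulVf// scale1r.
  have [nu nuE qexp_nu] := orthogonal_series_norm d_hilbert orth coefE s_cvg.
  have vecE : coherent_vector f alpha0 ket z = (`|c0| / c0) *: psi.
    rewrite /coherent_vector (cvg_lim (@norm_hausdorff _ _) s_cvg) scalerA.
    rewrite /qexp (cvg_lim (@norm_hausdorff _ _) qexp_nu).
    suff -> : (nu `^ (- 2^-1))%:C = `|c0| by [].
    have -> : nu = (Normc.normc c0)^-1 ^+ 2.
      apply: (@complexI R); rewrite -nuE normrZ psi_norm mulr1 normfV.
      by rewrite rmorphXn fmorphV.
    rewrite powRN powR12_sqrt ?sqr_ge0// sqrtr_sqr ger0_norm ?invrK//.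
    by rewrite invr_ge0 -lecR (normr_ge0 c0).
  split.
  - by apply/cvg_ex; exists nu.
  - by apply/cvg_ex; exists (c0^-1 *: psi).
  - exists (c0 / `|c0|).
      by rewrite normrM normfV normr_id mulfV// normr_eq0.
    by rewrite vecE scalerA mulrA divfK ?normr_eq0// mulfV// scale1r.
  - by move=> c0_ge0; rewrite vecE ger0_norm// mulfV// scale1r.
have s_cvg := orthogonal_series_cvg d_hilbert orth coefE qexp_cvg.
split=> //.
have [nu nuE qexp_nu] := orthogonal_series_norm d_hilbert orth coefE s_cvg.
have [dom_s a_s] := annihilation_coherent_series fock s_cvg.
(* The terms are nonnegative and the first one is 1. *)
have nu_gt0 : 0 < nu.
  apply: (@lt_le_trans _ _ (series
    (fun n => qexp_coef f alpha0 n * sqmod z ^+ n) 1%N)).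
    by rewrite /series /= big_nat1 /qexp_coef /qfact big_geq// invr1 mulr1.
  rewrite -(cvg_lim (@norm_hausdorff _ _) qexp_nu).
  apply: nondecreasing_cvgn_le => //; apply: nondecreasing_series => i _ _.
  by rewrite -ler0c -coefE exprn_ge0.
have vecE : coherent_vector f alpha0 ket z =
    (Num.sqrt nu)^-1%:C *: limn (series (coherent_term f alpha0 ket z)).
  rewrite /coherent_vector /qexp (cvg_lim (@norm_hausdorff _ _) qexp_nu).
  by rewrite powRN powR12_sqrt// ltW.
have [dom_v a_v] := operator_scale (Num.sqrt nu)^-1%:C dom_s.
rewrite vecE; split=> //; first by rewrite a_v a_s !scalerA mulrC.
rewrite /braket dnormZ -d_hilbert nuE normc_real -rmorphXn -rmorphM /=.
by rewrite real_normK ?num_real// exprVn sqr_sqrtr ?ltW// mulVf// gt_eqF.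
Qed.
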